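(* Let $n\in\mathbb N$. (a) If $4\mid n$, then $$\sum_{k=0}^n\binom nk\binom{2k}{k}\frac{u_k(2,2)}{(-4)^k}=0.$$ (b) If $n\equiv2\pmod 4$, then $$\sum_{k=0}^n\binom nk\binom{2k}{k}\frac{v_k(2,2)}{(-4)^k}=0.$$
   Context: For integers $A,B$, the Lucas sequences are defined by $u_0=0$, $u_1=1$, $u_{n+1}=Au_n-Bu_{n-1}$ and $v_0=2$, $v_1=A$, $v_{n+1}=Av_n-Bv_{n-1}$ for $n\ge1$; here $u_k(A,B),v_k(A,B)$ denote these sequences. *)

(* Defs.v *)
From mathcomp Require Import all_boot all_order all_algebra.

Set Implicit Arguments.
Unset Strict Implicit.
Unset Printing Implicit Defensive.

Import GRing.Theory.
Local Open Scope ring_scope.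

Fixpoint lucas_u (A B : int) (n : nat) : int :=
  match n with
  | 0%N => 0
  | S n' => match n' with
            | 0%N => 1
            | S m => A * lucas_u A B n' - B * lucas_u A B m
            end
  end.

Fixpoint lucas_v (A B : int) (n : nat) : int :=
  match n with
  | 0%N => 2
  | S n' => match n' with
            | 0%N => A
            | S m => A * lucas_v A B n' - B * lucas_v A B m
            end
  end.

(* Main.v *)
Require Import Defs.
From mathcomp Require Import all_boot all_order all_algebra.
From mathcomp Require Import algC ring.

(**
  Put [P_n t = \sum_k 'C(n, k) 'C(2k, k) (t / -4)^k], the mean of
  [(1 - t cos^2)^n] over the circle.  Exchanging [cos] and [sin] gives
  [P_n t = (1 - t)^n P_n (t / (t - 1))], and for [t = 1 + i] this reads
  [P_n (1 + i) = (-i)^n P_n (1 - i)].  By Binet's formulas the two sums are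
  [(P_n (1 + i) - P_n (1 - i)) / 2i] and [P_n (1 + i) + P_n (1 - i)].
  The means of [cos^(2a) sin^(2b)] enter only through their closed form
  [trig_moment a b] and the recurrence coming from [cos^2 + sin^2 = 1].
*)

Set Implicit Arguments.
Unset Strict Implicit.
Unset Printing Implicit Defensive.

Import GRing.Theory Num.Theory.
Local Open Scope ring_scope.

(** Pascal's rule: of the two summands of ['C(n.+1, k)], one raises the second index of [f], the
    other the first. *)
Lemma binomial_sum_recr (R : pzRingType) (f : nat -> nat -> R) (n : nat) :
  \sum_(k < n.+2) 'C(n.+1, k)%:R * f k (n.+1 - k)%N =
  \sum_(k < n.+1) 'C(n, k)%:R * (f k (n - k).+1 + f k.+1 (n - k)%N).
Proof.
under [RHS]eq_bigr do rewrite mulrDr.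
rewrite big_split /= big_ord_recl /= bin0 subn0.
under eq_bigr => k _ do rewrite /bump /= add1n subSS binS natrD mulrDl.
rewrite big_split /= addrA; congr (_ + _).
rewrite big_ord_recr /= bin_small // mul0r addr0 [RHS]big_ord_recl bin0 subn0.
congr (_ + _); apply: eq_bigr => k _.
by rewrite subnSK.
Qed.

(* Reading [c a b] as the value of a linear functional at [Y^a (1 - Y)^b],
   both sides are its value at [Y^a (1 - Y)^b (x (1 - Y) + y Y)^n]. *)
Lemma binomial_sum_moments (R : comPzRingType) (c : nat -> nat -> R)
    (x y : R) (n a b : nat) :
  (forall a b, c a b = c a.+1 b + c a b.+1) ->
  \sum_(k < n.+1) 'C(n, k)%:R *
    (x ^+ (n - k) * y ^+ k * c (a + k)%N (b + (n - k))%N) =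
  \sum_(k < n.+1) 'C(n, k)%:R *
    (x ^+ (n - k) * (y - x) ^+ k * c (a + k)%N b).
Proof.
move=> cE; elim: n a b => [|n IHn] a b.
  by rewrite !big_ord1 /= !addn0.
rewrite (binomial_sum_recr
  (fun k j => x ^+ j * y ^+ k * c (a + k)%N (b + j)%N)).
rewrite (binomial_sum_recr
  (fun k j => x ^+ j * (y - x) ^+ k * c (a + k)%N b)).
(* One factor [x (1 - Y) + y Y] is peeled off; it shifts [b] or [a], hence the induction for all [a]
   and [b]. *)
transitivity (x * (\sum_(k < n.+1) 'C(n, k)%:R *
      (x ^+ (n - k) * y ^+ k * c (a + k)%N (b.+1 + (n - k))%N)) +
    y * (\sum_(k < n.+1) 'C(n, k)%:R *
      (x ^+ (n - k) * y ^+ k * c (a.+1 + k)%N (b + (n - k))%N))).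
  rewrite !mulr_sumr -big_split /=; apply: eq_bigr => k _.
  rewrite !addnS !addSn !exprS; ring.
rewrite !IHn !mulr_sumr -big_split /=; apply: eq_bigr => k _.
rewrite !addnS !addSn !exprS (cE (a + k)%N b); ring.
Qed.

Section TrigMoments.
Variable F : numFieldType.
Implicit Types (a b n : nat) (t : F).

(* The mean of [cos^(2a) sin^(2b)] over the circle. *)
Definition trig_moment a b : F :=
  ((2 * a)`! * (2 * b)`!)%:R / (4 ^ (a + b) * (a`! * b`! * (a + b)`!))%:R.

Lemma trig_momentC a b : trig_moment a b = trig_moment b a.
Proof.
by rewrite /trig_moment (addnC b) (mulnC (2 * a)`!) (mulnC a`!).
Qed.

Lemma trig_moment_recl a b :
  trig_moment a.+1 b =
  trig_moment a b * ((2 * a).+1%:R / (2 * (a + b).+1%:R)).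
Proof.
rewrite /trig_moment (mulnS 2 a) add2n addSn expnS !factS !natrM.
have fact_neq0 m : m`!%:R != 0 :> F by rewrite pnatr_eq0 -lt0n fact_gt0.
have S_neq0 m : m.+1%:R != 0 :> F by rewrite pnatr_eq0.
have pow_neq0 m : (4 ^ m)%:R != 0 :> F by rewrite pnatr_eq0 expn_eq0.
have -> : (2 * a).+2%:R = 2 * a.+1%:R :> F.
  by rewrite -natrM mulnS add2n.
have -> : 4 = 2 * 2 :> F by rewrite -natrM.
by field; rewrite -natrD !nat1r !S_neq0 !fact_neq0 pow_neq0.
Qed.

Lemma trig_moment_split a b :
  trig_moment a b = trig_moment a.+1 b + trig_moment a b.+1.
Proof.
rewrite (trig_momentC a b.+1) !trig_moment_recl (trig_momentC b a) (addnC b).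
have d_neq0 : 2 * (a + b).+1%:R != 0 :> F.
  by rewrite -natrM pnatr_eq0.
(* The two ratios have numerators [2a + 1] and [2b + 1], which add up to their common
   denominator. *)
rewrite -mulrDr -mulrDl -natrD addSn addnS.
have -> : (2 * a + 2 * b).+2 = (2 * (a + b).+1)%N.
  by rewrite mulnS mulnDr.
by rewrite natrM divff // mulr1.
Qed.

Lemma trig_moment0r a : trig_moment a 0 = 'C(2 * a, a)%:R / 4 ^+ a.
Proof.
rewrite /trig_moment addn0 muln0 fact0 !muln1.
have fact_neq0 : a`!%:R != 0 :> F by rewrite pnatr_eq0 -lt0n fact_gt0.
have pow_neq0 : 4 ^+ a != 0 :> F by rewrite expf_neq0 // pnatr_eq0.
have le_a : (a <= 2 * a)%N by rewrite mul2n -addnn leq_addr.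
rewrite -(bin_fact le_a) mul2n -addnn addnK !natrM natrX.
by field; apply/andP.
Qed.

Definition central_sum n t : F :=
  \sum_(k < n.+1) 'C(n, k)%:R * 'C(2 * k, k)%:R * (t / - 4) ^+ k.

(** With [Y = cos^2], write [1 - t Y = (1 - Y) + (1 - t) Y]: this homogeneous form exposes the
    symmetry between [cos] and [sin]. *)
Lemma central_sumE n t :
  central_sum n t =
  \sum_(k < n.+1) 'C(n, k)%:R * ((1 - t) ^+ k * trig_moment k (n - k)).
Proof.
have := binomial_sum_moments 1 (1 - t) n 0 0 trig_moment_split.
under eq_bigr do rewrite expr1n mul1r !add0n.
move=> ->; apply: eq_bigr => k _.
rewrite expr1n mul1r add0n trig_moment0r -mulrA; congr (_ * _).
rewrite addrAC subrr add0r invrN mulrN -mulNr expr_div_n.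
by rewrite mulrCA.
Qed.

Lemma central_sum_reflect n t : t != 1 ->
  central_sum n t = (1 - t) ^+ n * central_sum n (t / (t - 1)).
Proof.
rewrite -subr_eq0 => t_neq1.
have t_neq1' : 1 - t != 0 by rewrite -oppr_eq0 opprB.
have -> : t / (t - 1) = 1 - (1 - t)^-1.
  by field; apply/andP.
rewrite !central_sumE subKr mulr_sumr.
(* Exchanging [cos] and [sin] amounts to reversing the sum, with
   [(1 - t)^(n - k) = (1 - t)^n (1 - t)^-k]. *)
rewrite (reindex_inj rev_ord_inj) /=; apply: eq_bigr => k _.
have le_kn : (k <= n)%N by rewrite -ltnS.
rewrite subSS bin_sub // subKn // trig_momentC exprVn expfB_cond; last first.
  by rewrite (negPf t_neq1').
ring.
Qed.

End TrigMoments.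

Section Binet.
Variables (F : fieldType) (al be : F) (A B : int).
Hypotheses (sumE : al + be = A%:~R) (prodE : al * be = B%:~R).

(** Both sides satisfy the recurrence whose characteristic roots are [al] and [be]; the factor
    [al - be] on the left avoids a division. *)
Lemma lucas_u_binet k : (al - be) * (lucas_u A B k)%:~R = al ^+ k - be ^+ k.
Proof.
elim/ltn_ind: k => -[|[|k]] IHk; rewrite ?expr0 ?expr1 ?mulr0 ?subrr ?mulr1 //.
rewrite -[lucas_u A B k.+2]/(A * lucas_u A B k.+1 - B * lucas_u A B k).
rewrite intrB !intrM -sumE -prodE mulrBr !(mulrCA (al - be)).
by rewrite !IHk // !exprS; ring.
Qed.

Lemma lucas_v_binet k : (lucas_v A B k)%:~R = al ^+ k + be ^+ k.
Proof.
elim/ltn_ind: k => -[|[|k]] IHk; rewrite ?expr0 ?expr1 //.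
rewrite -[lucas_v A B k.+2]/(A * lucas_v A B k.+1 - B * lucas_v A B k).
rewrite intrB !intrM -sumE -prodE !IHk // !exprS; ring.
Qed.

End Binet.

Lemma central_sum_1Di (n : nat) :
  central_sum n (1 + 'i : algC) = (- 'i) ^+ n * central_sum n (1 - 'i).
Proof.
have i_neq0 : 'i != 0 :> algC by exact: neq0Ci.
have tE : 1 + 'i - 1 = 'i :> algC by rewrite addrC addKr.
rewrite central_sum_reflect; last by rewrite -subr_eq0 tE.
rewrite tE opprD addrA subrr add0r mulrDl mul1r divff // invCi.
by rewrite [- 'i + 1]addrC.
Qed.

Theorem theorem1p5 (n : nat) :
  ((4 %| n)%N ->
     \sum_(0 <= k < n.+1)
       'C(n, k)%:R * 'C(2 * k, k)%:R * ((lucas_u 2 2 k)%:~R / (- 4%:R) ^+ k)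
     = 0 :> rat) /\
  ((n = 2 %[mod 4])%N ->
     \sum_(0 <= k < n.+1)
       'C(n, k)%:R * 'C(2 * k, k)%:R * ((lucas_v 2 2 k)%:~R / (- 4%:R) ^+ k)
     = 0 :> rat).
Proof.
(* [1 + 'i] and [1 - 'i] are the roots of [X^2 - 2X + 2], the characteristic polynomial for
   [A = B = 2]. *)
have sumE : (1 + 'i) + (1 - 'i) = 2%:~R :> algC by ring.
have prodE : (1 + 'i) * (1 - 'i) = 2%:~R :> algC.
  rewrite mulrC -subr_sqr sqrCi; ring.
have i4 : (- 'i) ^+ 4 = 1 :> algC.
  by rewrite (exprM _ 2 2) sqrrN sqrCi sqrrN expr1n.
have ratr_term (z : int) k :
    ratr ('C(n, k)%:R * 'C(2 * k, k)%:R * (z%:~R / (- 4%:R) ^+ k)) =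
    'C(n, k)%:R * 'C(2 * k, k)%:R * (z%:~R / (- 4) ^+ k) :> algC.
  by rewrite !rmorphM fmorphV rmorphXn rmorphN /= !ratr_nat ratr_int.
split=> n4; apply: (fmorph_inj (@ratr algC)).
- rewrite rmorph0 rmorph_sum big_mkord /=.
  have d_neq0 : (1 + 'i) - (1 - 'i) != 0 :> algC.
    have -> : (1 + 'i) - (1 - 'i) = 2 * 'i :> algC by ring.
    by rewrite mulf_neq0 ?pnatr_eq0 ?neq0Ci.
  apply: (mulfI d_neq0); rewrite mulr0.
  transitivity (central_sum n (1 + 'i : algC) - central_sum n (1 - 'i)).
    rewrite mulr_sumr -sumrB; apply: eq_bigr => k _.
    rewrite ratr_term mulrCA [(_ - _) * _]mulrA (lucas_u_binet sumE prodE).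
    rewrite !expr_div_n; ring.
  (* Here [(- 'i)^n = 1], so the two values coincide. *)
  have /dvdnP[q ->] := n4.
  by rewrite central_sum_1Di mulnC exprM i4 expr1n mul1r subrr.
- rewrite rmorph0 rmorph_sum big_mkord /=.
  transitivity (central_sum n (1 + 'i : algC) + central_sum n (1 - 'i)).
    rewrite -big_split; apply: eq_bigr => k _ /=.
    rewrite ratr_term (lucas_v_binet sumE prodE) !expr_div_n; ring.
  (* Here [(- 'i)^n = (- 'i)^2 = -1], so the two values are opposite. *)
  rewrite central_sum_1Di [in (- 'i) ^+ n](divn_eq n 4) n4 mulnC exprD exprM i4.
  by rewrite expr1n mul1r sqrrN sqrCi mulN1r addNr.
Qed.
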